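(* Let $R$ and $S$ be rings and let $\theta:R\to S$ be a ring homomorphism. Then $\theta$ determines a morphism of ringed spaces $(\hat\theta,\hat\theta^\#):\mathrm{NCSpec}(S)\to\mathrm{NCSpec}(R)$. Furthermore, $R\mapsto\mathrm{NCSpec}(R)$, $\theta\mapsto(\hat\theta,\hat\theta^\#)$ defines a faithful contravariant functor from the category of rings to the category of ringed spaces.
   Context: Rings are unital, not necessarily commutative, the zero ring (with $1=0$) is allowed, and ring homomorphisms preserve identity elements. A ringed space is a topological space with a sheaf of (not necessarily commutative) rings; a morphism $(X,\mathcal O_X)\to(Y,\mathcal O_Y)$ is a pair $(\phi,\phi^\#)$ with $\phi:X\to Y$ continuous and $\phi^\#:\mathcal O_Y\to\phi_*\mathcal O_X$ a morphism of sheaves of rings. Localization: for a subset $A$ of a ring $R$, $\alpha_A:R\to loc(R,A)$ denotes the universal ring homomorphism sending every element of $A$ to a unit: any ring homomorphism $R\to T$ sending every $a\in A$ to a unit factors uniquely through $\alpha_A$. Write $A\preceq B$ if $\alpha_B(a)$ is a unit in $loc(R,B)$ for all $a\in A$; then $p_{BA}:loc(R,A)\to loc(R,B)$ is the unique homomorphism with $p_{BA}\alpha_A=\alpha_B$. The relation $\preceq$ is a preorder on the set $L_0(R)$ of finite subsets of $R$; $L(R)$ is the poset of equivalence classes for $A\sim B\iff A\preceq B\preceq A$, and $R_A$ denotes the class of $A$, so $R_A\le R_B\iff A\preceq B$. The space $\mathrm{NCSpec}(R)$: give $L(R)$ the Alexandrov topology (open sets are the upper sets), with base $U_E=\{R_F:R_F\ge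 R_E\}$, and the unique sheaf of rings $\mathcal O$ with $\mathcal O(U_E)=loc(R,E)$ and restriction maps $p_{FE}$ for $U_F\subset U_E$. For a topological space $X$, its soberification $S(X)$ is the set of irreducible (in particular nonempty) closed subsets of $X$ with open sets $\widetilde U=\{C\in S(X):C\cap U\ne\varnothing\}$, $U$ open in $X$; $U\mapsto\widetilde U$ is an isomorphism of lattices of open sets. $\mathrm{NCSpec}(R)$ is $S(L(R))$ with the sheaf $\mathcal O(\widetilde U):=\mathcal O(U)$. The maps attached to $\theta:R\to S$: for $E\subset R$ finite, $\theta_E:loc(R,E)\to loc(S,\theta(E))$ is the unique homomorphism with $\theta_E\alpha_E=\alpha_{\theta(E)}\theta$. The map $\hat\theta:S(L(S))\to S(L(R))$ is $\hat\theta(C)=\{R_E\in L(R):S_{\theta(E)}\in C\}$ (the preimage of $C$ under $R_E\mapsto S_{\theta(E)}$), with $\hat\theta^{-1}(\widetilde{U_E})=\widetilde{U_{\theta(E)}}$. $\hat\theta^\#:\mathcal O_{\mathrm{NCSpec}(R)}\to\hat\theta_*\mathcal O_{\mathrm{NCSpec}(S)}$ is the unique morphism of sheaves of rings equal to $\theta_E$ on each $\widetilde{U_E}$. *)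

(* Defs.v *)
(* Rings are [pzRingType]: unlike [nzRingType], it allows 1 = 0. *)
From HB Require Import structures.
From mathcomp Require Import all_boot all_order all_algebra.
From mathcomp Require Import finmap all_classical topology.

Set Implicit Arguments.
Unset Strict Implicit.
Unset Printing Implicit Defensive.

Import Order.TTheory GRing.Theory.

Local Open Scope classical_set_scope.
Local Open Scope ring_scope.
Local Open Scope quotient_scope.

Record category := Category {
  obj :> Type;
  mor : obj -> obj -> Type;
  idc : forall X, mor X X;
  compc : forall X Y Z, mor Y Z -> mor X Y -> mor X Z;
  compc1 : forall X Y (f : mor X Y), compc f (idc X) = f;
  comp1c : forall X Y (f : mor X Y), compc (idc Y) f = f;
  compcA : forall X Y Z T (h : mor Z T) (g : mor Y Z) (f : mor X Y),
    compc h (compc g f) = compc (compc h g) f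
}.

Section ContravariantFunctors.
Variables (C D : category) (Fobj : C -> D).
Variable Fmap : forall X Y : C, mor X Y -> mor (Fobj Y) (Fobj X).

Record is_contravariant_functor : Prop := IsContravariantFunctor {
  fmap_id : forall X : C, Fmap (idc X) = idc (Fobj X);
  fmap_comp : forall (X Y Z : C) (g : mor Y Z) (f : mor X Y),
    Fmap (compc g f) = compc (Fmap f) (Fmap g)
}.

Definition is_faithful : Prop := forall X Y : C, injective (@Fmap X Y).
End ContravariantFunctors.

Lemma rmorphism_ext (R S : pzRingType) (f g : {rmorphism R -> S}) :
  f =1 g -> f = g.
Proof.
move=> /funext; case: f g => [f cf] [g cg] /= fg; case: _ / fg cg => cg.
congr GRing.RMorphism.Pack.
case: cf cg => [[[f0 fD]] [[f1 fM]]] [[[g0 gD]] [[g1 gM]]].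
by rewrite (Prop_irrelevance f0 g0) (Prop_irrelevance fD gD)
  (Prop_irrelevance f1 g1) (Prop_irrelevance fM gM).
Qed.

Definition ring_category : category.
Proof.
refine (@Category pzRingType (fun R S => {rmorphism R -> S})
  (fun R => idfun) (fun R S T g f => g \o f) _ _ _).
- by move=> *; apply: rmorphism_ext.
- by move=> *; apply: rmorphism_ext.
- by move=> *; apply: rmorphism_ext.
Defined.

Record opens (X : topologicalType) :=
  Opens { carrier :> set X ; opensP : open carrier }.

Definition capO (X : topologicalType) (U V : opens X) : opens X :=
  Opens (openI (opensP U) (opensP V)).

Lemma capOl (X : topologicalType) (U V : opens X) : capO U V `<=` U.
Proof. exact: subIsetl. Qed.

Lemma capOr (X : topologicalType) (U V : opens X) : capO U V `<=` V.
Proof. exact: subIsetr. Qed.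

Record presheaf (X : topologicalType) := Presheaf {
  sections :> opens X -> pzRingType;
  res : forall U V : opens X, V `<=` U -> {rmorphism sections U -> sections V};
  res_id : forall (U : opens X) (h : U `<=` U) s, res h s = s;
  res_comp : forall (U V W : opens X) (hVU : V `<=` U) (hWV : W `<=` V)
    (hWU : W `<=` U) s, res hWV (res hVU s) = res hWU s
}.
Arguments res {X} p {U V} h.
Arguments res_id {X} p {U} h s.
Arguments res_comp {X} p {U V W} hVU hWV hWU s.

Lemma res_res (X : topologicalType) (F : presheaf X) (U V W : opens X)
    (hVU : V `<=` U) (hWV : W `<=` V) (s : F U) :
  res F hWV (res F hVU s) = res F (subset_trans hWV hVU) s.
Proof. exact: res_comp. Qed.

Lemma res_irr (X : topologicalType) (F : presheaf X) (U V : opens X)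
    (h h' : V `<=` U) (s : F U) : res F h s = res F h' s.
Proof. by rewrite (Prop_irrelevance h h'). Qed.

Definition is_sheaf (X : topologicalType) (F : presheaf X) :=
  forall (U : opens X) (I : Type) (V : I -> opens X)
    (hV : forall i, V i `<=` U), U `<=` \bigcup_i V i ->
  forall s : forall i, F (V i),
    (forall i j, res F (@capOl _ (V i) (V j)) (s i) =
                 res F (@capOr _ (V i) (V j)) (s j)) ->
  exists! t : F U, forall i, res F (hV i) t = s i.

Record sheaf (X : topologicalType) :=
  Sheaf { presheaf_of :> presheaf X ; sheafP : is_sheaf presheaf_of }.

Record presheaf_hom (X : topologicalType) (F G : presheaf X) := PresheafHom {
  component :> forall U : opens X, {rmorphism F U -> G U};
  componentN : forall (U V : opens X) (h : V `<=` U) (s : F U),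
    component V (res F h s) = res G h (component U s)
}.

Section Pushforward.
Variables (X Y : topologicalType) (f : continuousType X Y).

Lemma open_preim (U : opens Y) : open (f @^-1` U).
Proof. by move: U => [U oU]; exact: (continuousP _).1 (@cts_fun _ _ f) U oU. Qed.

Definition preimO (U : opens Y) : opens X := Opens (open_preim U).

Lemma preimOS (U V : opens Y) : V `<=` U -> preimO V `<=` preimO U.
Proof. exact: preimage_subset. Qed.

Definition pushforward_presheaf (F : presheaf X) : presheaf Y :=
  @Presheaf Y (fun U => F (preimO U)) (fun U V h => res F (preimOS h))
    (fun U h => res_id F (preimOS h))
    (fun U V W h1 h2 h3 => res_comp F (preimOS h1) (preimOS h2) (preimOS h3)).

Lemma pushforward_is_sheaf (F : sheaf X) : is_sheaf (pushforward_presheaf F).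
Proof.
move=> U I V hV cov s compat.
have cov' : preimO U `<=` \bigcup_i preimO (V i).
  by move=> x /cov[i _ Vi]; exists i.
apply: (sheafP (fun i => preimOS (hV i)) cov') => i j.
have k : capO (preimO (V i)) (preimO (V j)) `<=` preimO (capO (V i) (V j)).
  exact: subset_refl.
rewrite -(res_comp F (preimOS (@capOl _ (V i) (V j))) k).
rewrite -(res_comp F (preimOS (@capOr _ (V i) (V j))) k).
by congr (res F k _); exact: compat.
Qed.

Definition pushforward (F : sheaf X) : sheaf Y :=
  Sheaf (@pushforward_is_sheaf F).
End Pushforward.

Record ringed_space := RingedSpace {
  space :> topologicalType;
  structure_sheaf : sheaf space
}.

Record rs_hom (X Y : ringed_space) := RsHom {
  rs_map :> continuousType X Y;
  rs_sharp : presheaf_hom (structure_sheaf Y)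
                          (pushforward rs_map (structure_sheaf X))
}.

Lemma rs_hom_ext (X Y : ringed_space) (f g : rs_hom X Y) :
  (forall x, f x = g x) ->
  (forall (U : opens Y) (h : preimO g U `<=` preimO f U)
     (s : structure_sheaf Y U),
     res (structure_sheaf X) h (rs_sharp f U s) = rs_sharp g U s) ->
  f = g.
Proof.
case: f g => [f ff] [g gg] /= fg.
have {}fg : f = g by apply/continuousEP.
case: _ / fg gg => gg H; congr RsHom.
case: ff gg H => [a aN] [b bN] /= H.
suff ab : a = b by case: _ / ab bN {H} => bN; rewrite (Prop_irrelevance aN bN).
apply: functional_extensionality_dep => U; apply: rmorphism_ext => s.
by rewrite -(H U (@subset_refl _ _)) res_id.
Qed.

Definition rs_sharp_id (X : ringed_space) :
  presheaf_hom (structure_sheaf X) (pushforward idfun (structure_sheaf X)).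
Proof.
refine (@PresheafHom _ _ (pushforward idfun (structure_sheaf X)) (fun U =>
  res (structure_sheaf X) (V := preimO idfun U) (@subset_refl _ U)) _).
by move=> U V h s /=; rewrite !res_res; exact: res_irr.
Defined.

Definition rs_id (X : ringed_space) : rs_hom X X := RsHom (rs_sharp_id X).

(* [preimO (g \o f) U] and [preimO f (preimO g U)] have convertible carriers
   but different openness proofs, whence the restriction along the identity
   inclusion. *)
Definition rs_sharp_comp (X Y Z : ringed_space) (g : rs_hom Y Z)
    (f : rs_hom X Y) :
  presheaf_hom (structure_sheaf Z) (pushforward (g \o f) (structure_sheaf X)).
Proof.
refine (@PresheafHom _ _ (pushforward (g \o f) (structure_sheaf X)) (fun U =>
  res (structure_sheaf X) (U := preimO f (preimO g U))
      (V := preimO (g \o f) U) (@subset_refl _ (preimO (g \o f) U))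
  \o (rs_sharp f (preimO g U) \o rs_sharp g U)) _).
move=> U V h s /=; rewrite !componentN /=.
by rewrite !res_res; exact: res_irr.
Defined.

Definition rs_comp (X Y Z : ringed_space) (g : rs_hom Y Z) (f : rs_hom X Y) :
  rs_hom X Z := RsHom (rs_sharp_comp g f).

Definition ringed_space_category : category.
Proof.
refine (@Category ringed_space rs_hom rs_id rs_comp _ _ _).
- move=> X Y f; apply: rs_hom_ext => // U h s /=.
  by rewrite !res_res; exact: res_id.
- move=> X Y f; apply: rs_hom_ext => // U h s /=.
  by rewrite componentN /= !res_res; exact: res_id.
- move=> X Y Z T h g f; apply: rs_hom_ext => // U k s /=.
  by rewrite componentN /= !res_res; exact: res_irr.
Defined.

(* [GRing.unit] is only available for nonzero rings. *)
Definition is_unit (R : pzRingType) (x : R) : Prop :=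
  exists y, x * y = 1 /\ y * x = 1.

Definition inverts (R T : pzRingType) (A : set R) (f : {rmorphism R -> T}) :=
  forall a, A a -> is_unit (f a).

(* [loc A] consists of the formal ring expressions in the elements of [R] and
   in inverses of the elements of [A], two expressions being identified when
   they have the same value under every homomorphism from [R] that inverts
   [A]. *)
Section Localization.
Variables (R : pzRingType) (A : set R).

Inductive loc_term : Type :=
| LocConst of R
| LocInv (a : R) of A a
| LocOpp of loc_term
| LocAdd of loc_term & loc_term
| LocMul of loc_term & loc_term.

HB.instance Definition _ := gen_eqMixin loc_term.
HB.instance Definition _ := gen_choiceMixin loc_term.

Fixpoint loc_eval (T : pzRingType) (f : {rmorphism R -> T})
    (Hf : inverts A f) (t : loc_term) : T :=
  match t with
  | LocConst r => f r
  | LocInv a Aa => sval (cid (Hf a Aa))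
  | LocOpp u => - loc_eval Hf u
  | LocAdd u v => loc_eval Hf u + loc_eval Hf v
  | LocMul u v => loc_eval Hf u * loc_eval Hf v
  end.

Definition loc_eqv (t u : loc_term) : bool :=
  `[< forall (T : pzRingType) (f : {rmorphism R -> T}) (Hf : inverts A f),
        loc_eval Hf t = loc_eval Hf u >].

Lemma loc_eqv_refl : reflexive loc_eqv.
Proof. by move=> t; apply/asboolP. Qed.

Lemma loc_eqv_sym : symmetric loc_eqv.
Proof.
by move=> t u; apply/idP/idP => /asboolP h; apply/asboolP => T f Hf; rewrite h.
Qed.

Lemma loc_eqv_trans : transitive loc_eqv.
Proof.
move=> u t v /asboolP h1 /asboolP h2; apply/asboolP => T f Hf.
by rewrite h1 h2.
Qed.

Canonical loc_equiv := EquivRel loc_eqv loc_eqv_refl loc_eqv_sym loc_eqv_trans.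

Definition loc : Type := {eq_quot loc_eqv}.

HB.instance Definition _ := Choice.on loc.
HB.instance Definition _ := EqQuotient.on loc.

Lemma loc_piP (t u : loc_term) :
  \pi_loc t = \pi_loc u <->
  forall (T : pzRingType) (f : {rmorphism R -> T}) (Hf : inverts A f),
    loc_eval Hf t = loc_eval Hf u.
Proof. by split=> [/eqquotP/asboolP//|h]; apply/eqquotP/asboolP. Qed.

Lemma loc_eval_repr (T : pzRingType) (f : {rmorphism R -> T})
    (Hf : inverts A f) (t : loc_term) :
  loc_eval Hf (repr (\pi_loc t)) = loc_eval Hf t.
Proof. by move: T f Hf; apply/loc_piP; rewrite reprK. Qed.

Definition loc_opp (x : loc) : loc := \pi_loc (LocOpp (repr x)).
Definition loc_add (x y : loc) : loc := \pi_loc (LocAdd (repr x) (repr y)).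
Definition loc_mul (x y : loc) : loc := \pi_loc (LocMul (repr x) (repr y)).

Ltac loc_tac := rewrite /loc_add /loc_mul /loc_opp; apply/loc_piP => ? ? ?;
  rewrite /= ?loc_eval_repr /= ?loc_eval_repr /=.

Lemma loc_addA : associative loc_add.
Proof. by move=> x y z; loc_tac; rewrite addrA. Qed.
Lemma loc_addC : commutative loc_add.
Proof. by move=> x y; loc_tac; rewrite addrC. Qed.
Lemma loc_add0 : left_id (\pi_loc (LocConst 0)) loc_add.
Proof. by move=> x; rewrite -{2}[x]reprK; loc_tac; rewrite rmorph0 add0r. Qed.
Lemma loc_addN : left_inverse (\pi_loc (LocConst 0)) loc_opp loc_add.
Proof. by move=> x; loc_tac; rewrite rmorph0 addNr. Qed.
Lemma loc_mulA : associative loc_mul.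
Proof. by move=> x y z; loc_tac; rewrite mulrA. Qed.
Lemma loc_mul1 : left_id (\pi_loc (LocConst 1)) loc_mul.
Proof. by move=> x; rewrite -{2}[x]reprK; loc_tac; rewrite rmorph1 mul1r. Qed.
Lemma loc_mulr1 : right_id (\pi_loc (LocConst 1)) loc_mul.
Proof. by move=> x; rewrite -{2}[x]reprK; loc_tac; rewrite rmorph1 mulr1. Qed.
Lemma loc_mulDl : left_distributive loc_mul loc_add.
Proof. by move=> x y z; loc_tac; rewrite mulrDl. Qed.
Lemma loc_mulDr : right_distributive loc_mul loc_add.
Proof. by move=> x y z; loc_tac; rewrite mulrDr. Qed.

HB.instance Definition _ := GRing.isPzRing.Build loc
  loc_addA loc_addC loc_add0 loc_addN
  loc_mulA loc_mul1 loc_mulr1 loc_mulDl loc_mulDr.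

Definition loc_alpha (r : R) : loc := \pi_loc (LocConst r).

Lemma loc_alpha_nmod_morphism : nmod_morphism loc_alpha.
Proof.
split=> // x y; rewrite [RHS]/(loc_add _ _) /loc_alpha; loc_tac.
by rewrite rmorphD.
Qed.

Lemma loc_alpha_monoid_morphism : monoid_morphism loc_alpha.
Proof.
split=> // x y; rewrite [RHS]/(loc_mul _ _) /loc_alpha; loc_tac.
by rewrite rmorphM.
Qed.

HB.instance Definition _ :=
  GRing.isNmodMorphism.Build R loc loc_alpha loc_alpha_nmod_morphism.
HB.instance Definition _ :=
  GRing.isMonoidMorphism.Build R loc loc_alpha loc_alpha_monoid_morphism.

Lemma loc_alpha_inverts : inverts A loc_alpha.
Proof.
move=> a Aa; exists (\pi_loc (LocInv Aa)); split.
  rewrite [LHS]/(loc_mul _ _); loc_tac.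
  by rewrite rmorph1; case: cid => y /= [].
rewrite [LHS]/(loc_mul _ _); loc_tac.
by rewrite rmorph1; case: cid => y /= [].
Qed.

Section Lift.
Variables (T : pzRingType) (f : {rmorphism R -> T}) (Hf : inverts A f).

Definition loc_lift (x : loc) : T := loc_eval Hf (repr x).

Lemma loc_lift_nmod_morphism : nmod_morphism loc_lift.
Proof.
by split=> [|x y]; rewrite /loc_lift loc_eval_repr //= rmorph0.
Qed.

Lemma loc_lift_monoid_morphism : monoid_morphism loc_lift.
Proof.
by split=> [|x y]; rewrite /loc_lift loc_eval_repr //= rmorph1.
Qed.

HB.instance Definition _ :=
  GRing.isNmodMorphism.Build loc T loc_lift loc_lift_nmod_morphism.
HB.instance Definition _ :=
  GRing.isMonoidMorphism.Build loc T loc_lift loc_lift_monoid_morphism.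

Lemma loc_lift_alpha (r : R) : loc_lift (loc_alpha r) = f r.
Proof. by rewrite /loc_lift loc_eval_repr. Qed.

Lemma loc_lift_unique (g : {rmorphism loc -> T}) :
  (forall r, g (loc_alpha r) = f r) -> g =1 loc_lift.
Proof.
move=> gf x; rewrite -[x]reprK; elim: (repr x) => [r|a Aa|t IH|t IHt u IHu|t IHt u IHu].
- by rewrite -/(loc_alpha r) loc_lift_alpha gf.
- rewrite [RHS]loc_eval_repr /=; case: cid => z /= [az za].
  set y : loc := \pi_loc _.
  have ya : y * loc_alpha a = 1.
    rewrite [LHS]/(loc_mul _ _); loc_tac.
    by rewrite rmorph1; case: cid => w /= [].
  rewrite -[LHS]mulr1 -az mulrA -gf -rmorphM ya rmorph1.
  by rewrite mul1r.
- have -> : \pi_loc (LocOpp t) = - (\pi_loc t : loc).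
    by rewrite [RHS]/(loc_opp _); loc_tac.
  by rewrite !rmorphN IH.
- have -> : \pi_loc (LocAdd t u) = (\pi_loc t : loc) + \pi_loc u.
    by rewrite [RHS]/(loc_add _ _); loc_tac.
  by rewrite !rmorphD IHt IHu.
- have -> : \pi_loc (LocMul t u) = (\pi_loc t : loc) * \pi_loc u.
    by rewrite [RHS]/(loc_mul _ _); loc_tac.
  by rewrite !rmorphM IHt IHu.
Qed.
End Lift.
End Localization.

Arguments loc {R} A.
Arguments loc_alpha {R} A r.
Arguments loc_alpha_inverts {R} A a _.

Section FiniteLocalizations.
Variable R : pzRingType.

Definition locf (E : {fset R}) : pzRingType := loc [set` E].
Definition alphaf (E : {fset R}) : {rmorphism R -> locf E} :=
  loc_alpha [set` E].

Definition loc_le (E F : {fset R}) : Prop := inverts [set` E] (alphaf F).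

Definition locp (E F : {fset R}) (h : loc_le E F) :
  {rmorphism locf E -> locf F} := loc_lift h.

Lemma locp_alpha E F (h : loc_le E F) r : locp h (alphaf E r) = alphaf F r.
Proof. exact: loc_lift_alpha. Qed.

Lemma locf_rmorph_eq (T : pzRingType) E (f g : {rmorphism locf E -> T}) :
  (forall r, f (alphaf E r) = g (alphaf E r)) -> f =1 g.
Proof.
move=> fg x.
have Hg : inverts [set` E] (g \o alphaf E).
  move=> a /loc_alpha_inverts[y [ay ya]]; exists (g y).
  by rewrite /= -!rmorphM ay ya rmorph1.
by rewrite (@loc_lift_unique _ _ _ _ Hg f fg) (@loc_lift_unique _ _ _ _ Hg g).
Qed.

Lemma locp_uniq E F (h : loc_le E F) (g : {rmorphism locf E -> locf F}) :
  (forall r, g (alphaf E r) = alphaf F r) -> g =1 locp h.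
Proof. by move=> gE; apply: locf_rmorph_eq => r; rewrite gE locp_alpha. Qed.

Lemma loc_le_refl E : loc_le E E.
Proof. exact: (@loc_alpha_inverts R [set` E]). Qed.

Lemma loc_le_trans E F G : loc_le E F -> loc_le F G -> loc_le E G.
Proof.
move=> EF FG a /EF[y [ay ya]]; exists (locp FG y).
by rewrite -(locp_alpha FG) -!rmorphM ay ya rmorph1.
Qed.

Lemma loc_le_sub (E F : {fset R}) : {subset E <= F} -> loc_le E F.
Proof. by move=> EF a /EF; exact: (@loc_alpha_inverts R [set` F]). Qed.

Lemma locp_id E (h : loc_le E E) x : locp h x = x.
Proof. by symmetry; apply: (locp_uniq h (g := idfun)). Qed.

Lemma locp_comp E F G (EF : loc_le E F) (FG : loc_le F G) (EG : loc_le E G) x :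
  locp FG (locp EF x) = locp EG x.
Proof.
by apply: (locp_uniq EG (g := locp FG \o locp EF)) => r /=; rewrite !locp_alpha.
Qed.

Definition L_eqv (E F : {fset R}) : bool := `[< loc_le E F /\ loc_le F E >].

Lemma L_eqv_refl : reflexive L_eqv.
Proof. by move=> E; apply/asboolP; split; exact: loc_le_refl. Qed.

Lemma L_eqv_sym : symmetric L_eqv.
Proof. by move=> E F; apply/idP/idP => /asboolP[? ?]; exact/asboolP. Qed.

Lemma L_eqv_trans : transitive L_eqv.
Proof.
move=> F E G /asboolP[? ?] /asboolP[? ?]; apply/asboolP.
by split; apply: (@loc_le_trans _ F).
Qed.

Canonical L_equiv := EquivRel L_eqv L_eqv_refl L_eqv_sym L_eqv_trans.

Definition locposet : Type := {eq_quot L_eqv}.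
HB.instance Definition _ := Choice.on locposet.
HB.instance Definition _ := EqQuotient.on locposet.

Definition cls (E : {fset R}) : locposet := \pi_locposet E.

Definition locposet_le (x y : locposet) : bool := `[< loc_le (repr x) (repr y) >].

Lemma cls_eq E F : cls E = cls F <-> loc_le E F /\ loc_le F E.
Proof. by split=> [/eqquotP/asboolP//|h]; apply/eqquotP/asboolP. Qed.

Lemma locposet_leE E F : locposet_le (cls E) (cls F) = `[< loc_le E F >].
Proof.
have [E1 E2] : loc_le (repr (cls E)) E /\ loc_le E (repr (cls E)).
  by apply/cls_eq; rewrite /cls reprK.
have [F1 F2] : loc_le (repr (cls F)) F /\ loc_le F (repr (cls F)).
  by apply/cls_eq; rewrite /cls reprK.
apply: asbool_equiv_eq; split=> h.
  exact: loc_le_trans E2 (loc_le_trans h F1).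
exact: loc_le_trans E1 (loc_le_trans h F2).
Qed.

Lemma locposet_refl : reflexive locposet_le.
Proof. by move=> x; apply/asboolP; exact: loc_le_refl. Qed.

Lemma locposet_anti : antisymmetric locposet_le.
Proof.
move=> x y /andP[/asboolP xy /asboolP yx].
by rewrite -[x]reprK -[y]reprK; apply/cls_eq.
Qed.

Lemma locposet_trans : transitive locposet_le.
Proof.
move=> y x z /asboolP xy /asboolP yz; apply/asboolP.
exact: loc_le_trans xy yz.
Qed.

Fact locposet_display : Order.disp_t. Proof. exact: Order.Disp tt tt. Qed.

HB.instance Definition _ := Order.Le_isPOrder.Build locposet_display locposet
  locposet_refl locposet_anti locposet_trans.

Lemma le_cls E F : (cls E <= cls F)%O <-> loc_le E F.
Proof.
rewrite -[(_ <= _)%O]/(locposet_le _ _) locposet_leE.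
by split=> /asboolP.
Qed.

Definition upper_set (U : set locposet) : Prop :=
  forall x y, U x -> (x <= y)%O -> U y.

Lemma upper_setT : upper_set setT. Proof. by []. Qed.

Lemma upper_setI : setI_closed upper_set.
Proof.
by move=> U V uU uV x y [Ux Vx] xy; split; [apply: uU xy|apply: uV xy].
Qed.

Lemma upper_set_bigU (I : Type) (f : I -> set locposet) :
  (forall i, upper_set (f i)) -> upper_set (\bigcup_i f i).
Proof. by move=> uf x y [i _ fx] xy; exists i => //; apply: uf xy. Qed.

HB.instance Definition _ := isOpenTopological.Build locposet
  upper_setT upper_setI upper_set_bigU.

Lemma open_upper (U : set locposet) : open U <-> upper_set U.
Proof. by []. Qed.

Lemma open_basic (E : {fset R}) : open [set x | (cls E <= x)%O].
Proof. by apply/open_upper => x y /= Ex; apply: le_trans. Qed.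

Definition basicL (E : {fset R}) : opens locposet := Opens (@open_basic E).

(* A section over an upper set is a compatible family of elements of the rings
   [loc(R,E)] for [R_E] in that set, indexed by all representatives [E] of the
   classes.  Over the basic open set [U_E] evaluation at [E] is an isomorphism
   onto [loc(R,E)] under which the restrictions are the maps [p_FE]: see
   [basic_ev_bij] and [basic_ev_res]. *)
Record Lsection (U : set locposet) := LSection {
  lval : forall E, U (cls E) -> locf E;
  lvalP : forall E F (hE : U (cls E)) (hF : U (cls F)) (h : loc_le E F),
    locp h (lval hE) = lval hF
}.

Section LsectionRing.
Variable U : set locposet.

HB.instance Definition _ := gen_eqMixin (Lsection U).
HB.instance Definition _ := gen_choiceMixin (Lsection U).

Lemma Lsection_ext (s t : Lsection U) :
  (forall E (h : U (cls E)), lval s h = lval t h) -> s = t.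
Proof.
case: s t => [s sP] [t tP] /= st.
have {}st : s = t.
  by do 2![apply: functional_extensionality_dep => ?]; exact: st.
by case: _ / st tP => tP; rewrite (Prop_irrelevance sP tP).
Qed.

Definition Lsection0 : Lsection U.
Proof. by exists (fun E _ => 0) => *; rewrite rmorph0. Defined.

Definition Lsection1 : Lsection U.
Proof. by exists (fun E _ => 1) => *; rewrite rmorph1. Defined.

Definition Lsection_opp (s : Lsection U) : Lsection U.
Proof.
by exists (fun E h => - lval s h) => E F hE hF h; rewrite rmorphN (lvalP _ _ hF).
Defined.

Definition Lsection_add (s t : Lsection U) : Lsection U.
Proof.
exists (fun E h => lval s h + lval t h) => E F hE hF h.
by rewrite rmorphD !(lvalP _ _ hF).
Defined.

Definition Lsection_mul (s t : Lsection U) : Lsection U.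
Proof.
exists (fun E h => lval s h * lval t h) => E F hE hF h.
by rewrite rmorphM !(lvalP _ _ hF).
Defined.

Lemma Lsection_addA : associative Lsection_add.
Proof. by move=> *; apply: Lsection_ext => * /=; rewrite addrA. Qed.
Lemma Lsection_addC : commutative Lsection_add.
Proof. by move=> *; apply: Lsection_ext => * /=; rewrite addrC. Qed.
Lemma Lsection_add0 : left_id Lsection0 Lsection_add.
Proof. by move=> *; apply: Lsection_ext => * /=; rewrite add0r. Qed.
Lemma Lsection_addN : left_inverse Lsection0 Lsection_opp Lsection_add.
Proof. by move=> *; apply: Lsection_ext => * /=; rewrite addNr. Qed.
Lemma Lsection_mulA : associative Lsection_mul.
Proof. by move=> *; apply: Lsection_ext => * /=; rewrite mulrA. Qed.
Lemma Lsection_mul1 : left_id Lsection1 Lsection_mul.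
Proof. by move=> *; apply: Lsection_ext => * /=; rewrite mul1r. Qed.
Lemma Lsection_mulr1 : right_id Lsection1 Lsection_mul.
Proof. by move=> *; apply: Lsection_ext => * /=; rewrite mulr1. Qed.
Lemma Lsection_mulDl : left_distributive Lsection_mul Lsection_add.
Proof. by move=> *; apply: Lsection_ext => * /=; rewrite mulrDl. Qed.
Lemma Lsection_mulDr : right_distributive Lsection_mul Lsection_add.
Proof. by move=> *; apply: Lsection_ext => * /=; rewrite mulrDr. Qed.

HB.instance Definition _ := GRing.isPzRing.Build (Lsection U)
  Lsection_addA Lsection_addC Lsection_add0 Lsection_addN
  Lsection_mulA Lsection_mul1 Lsection_mulr1 Lsection_mulDl Lsection_mulDr.

Section Evaluation.
Variables (E : {fset R}) (UE : U (cls E)).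

Definition Lev (s : Lsection U) : locf E := lval s UE.

Lemma Lev_nmod_morphism : nmod_morphism Lev. Proof. by []. Qed.
Lemma Lev_monoid_morphism : monoid_morphism Lev. Proof. by []. Qed.

HB.instance Definition _ :=
  GRing.isNmodMorphism.Build (Lsection U) (locf E) Lev Lev_nmod_morphism.
HB.instance Definition _ :=
  GRing.isMonoidMorphism.Build (Lsection U) (locf E) Lev Lev_monoid_morphism.
End Evaluation.
End LsectionRing.

Section LsectionRestriction.
Variables (U V : set locposet) (h : V `<=` U).

Definition Lres (s : Lsection U) : Lsection V :=
  LSection (fun E F hE hF => lvalP s (h hE) (h hF)).

Lemma Lres_nmod_morphism : nmod_morphism Lres.
Proof. by split=> [|x y]; apply: (@Lsection_ext V). Qed.

Lemma Lres_monoid_morphism : monoid_morphism Lres.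
Proof. by split=> [|x y]; apply: (@Lsection_ext V). Qed.

HB.instance Definition _ := GRing.isNmodMorphism.Build
  (Lsection U) (Lsection V) Lres Lres_nmod_morphism.
HB.instance Definition _ := GRing.isMonoidMorphism.Build
  (Lsection U) (Lsection V) Lres Lres_monoid_morphism.
End LsectionRestriction.

Lemma lval_irr (U : set locposet) (s : Lsection U) E (h h' : U (cls E)) :
  lval s h = lval s h'.
Proof. by rewrite (Prop_irrelevance h h'). Qed.

Definition Lpresheaf : presheaf locposet.
Proof.
refine (@Presheaf locposet (fun U => Lsection U) (fun U V h => Lres h) _ _).
- by move=> U h s; apply: Lsection_ext => E hE /=; exact: lval_irr.
- by move=> U V W h1 h2 h3 s; apply: Lsection_ext => E hE /=; exact: lval_irr.
Defined.

Lemma Lpresheaf_is_sheaf : is_sheaf Lpresheaf.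
Proof.
move=> U I V hV cov s compat.
have sE E i j (hi : carrier (V i) (cls E)) (hj : carrier (V j) (cls E)) :
    lval (s i) hi = lval (s j) hj.
  have /(congr1 (fun t => lval t (conj hi hj))) /= := compat i j.
  by rewrite (lval_irr _ _ hi) (lval_irr _ _ hj).
have covE E (h : carrier U (cls E)) : {i | carrier (V i) (cls E)}.
  by apply: cid; have [i _ Vi] := cov _ h; exists i.
have tP E F (hE : carrier U (cls E)) (hF : carrier U (cls F)) (h : loc_le E F) :
    locp h (lval (s (sval (covE E hE))) (svalP (covE E hE))) =
    lval (s (sval (covE F hF))) (svalP (covE F hF)).
  move: (svalP (covE E hE)); set i := sval (covE E hE) => Vi.
  have ViF : carrier (V i) (cls F).
    by have /open_upper up := opensP (V i); apply: up Vi _; apply/le_cls.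
  by rewrite (lvalP _ _ ViF); exact: sE.
exists (LSection tP); split=> [i|t ts].
  by apply: Lsection_ext => E h /=; exact: sE.
apply: Lsection_ext => E h /=; rewrite -ts /=; exact: lval_irr.
Qed.

Definition Lsheaf : sheaf locposet := Sheaf Lpresheaf_is_sheaf.

Definition basic_ev (E : {fset R}) : {rmorphism Lsheaf (basicL E) -> locf E} :=
  @Lev (basicL E) E (lexx (cls E)).

Lemma basic_ev_bij E : bijective (basic_ev E).
Proof.
have gP x F G (hF : (cls E <= cls F)%O) (hG : (cls E <= cls G)%O)
    (h : loc_le F G) :
    locp h (locp ((le_cls E F).1 hF) x) = locp ((le_cls E G).1 hG) x.
  exact: locp_comp.
exists (fun x => @LSection (basicL E) _ (gP x)) => [s|x]; last exact: locp_id.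
by apply: Lsection_ext => F h /=; exact: lvalP.
Qed.

Lemma basic_ev_res E F (EF : loc_le E F) (h : basicL F `<=` basicL E)
    (s : Lsheaf (basicL E)) :
  basic_ev F (res Lsheaf h s) = locp EF (basic_ev E s).
Proof. by symmetry; exact: lvalP. Qed.

End FiniteLocalizations.

Definition irreducible (X : topologicalType) (C : set X) : Prop :=
  C !=set0 /\ forall A B : set X, closed A -> closed B ->
    C `<=` A `|` B -> C `<=` A \/ C `<=` B.

Record soberification (X : topologicalType) := Soberification {
  sob_set : set X;
  sob_closed : closed sob_set;
  sob_irreducible : irreducible sob_set
}.

Section SoberTopology.
Variable X : topologicalType.

HB.instance Definition _ := gen_eqMixin (soberification X).
HB.instance Definition _ := gen_choiceMixin (soberification X).

Lemma sob_ext (C D : soberification X) : sob_set C = sob_set D -> C = D.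
Proof.
case: C D => [C cC iC] [D cD iD] /= CD; case: _ / CD cD iD => cD iD.
by rewrite (Prop_irrelevance cC cD) (Prop_irrelevance iC iD).
Qed.

Definition tilde (U : set X) : set (soberification X) :=
  [set C | sob_set C `&` U !=set0].

Definition sob_open (W : set (soberification X)) : Prop :=
  exists2 U : set X, open U & W = tilde U.

Lemma sob_openT : sob_open setT.
Proof.
exists setT; first exact: openT.
apply/seteqP; split=> // C _ /=; rewrite /tilde /= setIT.
exact: (sob_irreducible C).1.
Qed.

Lemma sob_openI : setI_closed sob_open.
Proof.
move=> _ _ [U oU ->] [V oV ->]; exists (U `&` V); first exact: openI.
apply/seteqP; split=> C /=; last first.
  by move=> [x [Cx [Ux Vx]]]; split; exists x.
move=> [[x [Cx Ux]] [y [Cy Vy]]]; apply: contrapT => CUV.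
have [_ /(_ (~` U) (~` V))] := sob_irreducible C.
case=> [| |z Cz|CU|CV]; rewrite ?closedC //.
- by rewrite -setCI => UVz; apply: CUV; exists z.
- exact: CU Cx Ux.
- exact: CV Cy Vy.
Qed.

Lemma sob_open_bigU (I : Type) (f : I -> set (soberification X)) :
  (forall i, sob_open (f i)) -> sob_open (\bigcup_i f i).
Proof.
move=> of_; exists (\bigcup_i s2val (cid2 (of_ i))).
  by apply: bigcup_open => i _; case: (cid2 (of_ i)).
apply/seteqP; split=> [C [i _]|C [x [Cx [i _]]]].
  by case E : (cid2 (of_ i)) => [U oU fU]; rewrite fU => -[x [Cx Ux]];
     exists x; split=> //; exists i => //; rewrite E.
case E : (cid2 (of_ i)) => [U oU fU] /= Ux; exists i => //.
by rewrite fU; exists x.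
Qed.

HB.instance Definition _ := isOpenTopological.Build (soberification X)
  sob_openT sob_openI sob_open_bigU.

Lemma open_tilde (U : opens X) : open (tilde U).
Proof. by exists U => //; exact: opensP. Qed.

Definition tildeO (U : opens X) : opens (soberification X) :=
  Opens (open_tilde U).

Lemma irreducible_closure1 (x : X) : irreducible (closure [set x]).
Proof.
have xx : closure [set x] x by exact: subset_closure.
split=> [|A B cA cB sAB]; first by exists x.
case: (sAB x xx) => [Ax|Bx]; [left|right]; rewrite closureE => y; apply.
  by split=> // _ ->.
by split=> // _ ->.
Qed.

Definition sober_unit (x : X) : soberification X :=
  Soberification (@closed_closure _ [set x]) (irreducible_closure1 x).

Lemma sober_unit_tilde (U : set X) : open U -> sober_unit @^-1` (tilde U) = U.
Proof.
move=> oU; apply/seteqP; split=> x /=; last first.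
  by move=> Ux; exists x; split=> //; exact: subset_closure.
move=> [y [/= xy Uy]].
by have [z [-> //]] := xy U (open_nbhs_nbhs (conj oU Uy)).
Qed.

Lemma sober_unit_continuous : continuous sober_unit.
Proof. by apply/continuousP => _ [U oU ->]; rewrite sober_unit_tilde. Qed.

HB.instance Definition _ := @isContinuous.Build X (soberification X) sober_unit
  sober_unit_continuous.
End SoberTopology.

(* The pushforward along [sober_unit] takes the value [O(U)] on [tilde U], as
   the preimage of [tilde U] is [U]: see [sober_unit_tilde]. *)
Definition NCSpec (R : pzRingType) : ringed_space :=
  @RingedSpace (soberification (locposet R))
    (pushforward (@sober_unit (locposet R)) (Lsheaf R)).

Section NCSpecBasic.
Variable R : pzRingType.

Definition basicO (E : {fset R}) : opens (NCSpec R) := tildeO (basicL E).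

Lemma basicO_cls (E : {fset R}) : carrier (basicO E) (sober_unit (cls E)).
Proof.
by exists (cls E); split; [exact: subset_closure|exact: lexx].
Qed.

(* The identification of [O(tilde U_E)] with [loc(R,E)]; it is bijective by
   [NCSpec_ev_bij]. *)
Definition NCSpec_ev (E : {fset R}) :
    {rmorphism structure_sheaf (NCSpec R) (basicO E) -> locf E} :=
  @Lev R (preimO (@sober_unit (locposet R)) (basicO E)) E (basicO_cls E).

Lemma basicO_preim (E : {fset R}) :
  carrier (preimO (@sober_unit (locposet R)) (basicO E)) = basicL E.
Proof. exact: (sober_unit_tilde (opensP (basicL E))). Qed.

Lemma basicO_sub (E : {fset R}) :
  basicL E `<=` preimO (@sober_unit (locposet R)) (basicO E).
Proof. by rewrite basicO_preim; exact: subset_refl. Qed.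

Lemma basicO_sup (E : {fset R}) :
  preimO (@sober_unit (locposet R)) (basicO E) `<=` basicL E.
Proof. by rewrite basicO_preim; exact: subset_refl. Qed.

Lemma NCSpec_evE (E : {fset R}) (s : structure_sheaf (NCSpec R) (basicO E)) :
  NCSpec_ev E s = basic_ev E (res (Lsheaf R) (@basicO_sub E) s).
Proof. exact: lval_irr. Qed.

Lemma NCSpec_ev_bij (E : {fset R}) : bijective (NCSpec_ev E).
Proof.
have [g bg gb] := basic_ev_bij E.
exists (fun x => res (Lsheaf R) (@basicO_sup E) (g x)).
  by move=> s; rewrite NCSpec_evE bg res_res; exact: res_id.
by move=> x; rewrite NCSpec_evE res_res res_id gb.
Qed.

Lemma NCSpec_ev_res E F (EF : loc_le E F) (h : basicO F `<=` basicO E)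
    (s : structure_sheaf (NCSpec R) (basicO E)) :
  NCSpec_ev F (res (structure_sheaf (NCSpec R)) h s) =
  locp EF (NCSpec_ev E s).
Proof. by symmetry; exact: lvalP. Qed.
End NCSpecBasic.

Section RingHom.
Variables (R S : pzRingType) (theta : {rmorphism R -> S}).

Definition fim (E : {fset R}) : {fset S} := [fset theta x | x in E]%fset.

Lemma inverts_fim (E : {fset R}) :
  inverts [set` E] (alphaf (fim E) \o theta).
Proof.
move=> a aE; apply: (@loc_alpha_inverts S [set` fim E]).
exact: in_imfset.
Qed.

Definition loc_theta (E : {fset R}) : {rmorphism locf E -> locf (fim E)} :=
  loc_lift (@inverts_fim E).

Lemma loc_theta_alpha E r :
  loc_theta E (alphaf E r) = alphaf (fim E) (theta r).
Proof. exact: loc_lift_alpha. Qed.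

Lemma loc_theta_uniq E (g : {rmorphism locf E -> locf (fim E)}) :
  (forall r, g (alphaf E r) = alphaf (fim E) (theta r)) -> g =1 loc_theta E.
Proof.
by move=> gE; apply: locf_rmorph_eq => r; rewrite gE loc_theta_alpha.
Qed.

(* The second clause says that the preimage of [tilde U_E] is
   [tilde U_theta(E)] and that, under the identifications [NCSpec_ev], the
   homomorphism [f^#] is [theta_E] on [tilde U_E]. *)
Definition is_NCSpec_map (f : rs_hom (NCSpec S) (NCSpec R)) : Prop :=
  (forall C : soberification (locposet S),
     sob_set (f C) = [set cls E | E in [set E | sob_set C (cls (fim E))]]) /\
  (forall E : {fset R},
     f @^-1` (basicO E) = basicO (fim E) /\
     forall (h : basicO (fim E) `<=` preimO f (basicO E))
            (s : structure_sheaf (NCSpec R) (basicO E)),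
       NCSpec_ev (fim E) (res (structure_sheaf (NCSpec S)) h
                            (rs_sharp f (basicO E) s)) =
       loc_theta E (NCSpec_ev E s)).
End RingHom.

(* Main.v *)
(** A point of [S(L(R))] is an ideal of the poset [L(R)]: in the Alexandrov
    topology closed sets are lower sets and irreducible ones are directed.  As
    [theta(E u F) = theta(E) u theta(F)], preimages of ideals are ideals, which
    gives the map on points.  The point of [L(S)] given by [G] maps into an open
    set [U] iff some [E] in [U] satisfies [theta(E) <= G], and then naturality
    of [theta_E] in [E] forces the value of the image of a section [s] at [G] to
    be [p_(G,theta(E)) (theta_E (s_E))]; this does not depend on [E], since two
    choices can be compared through their union.  The formula yields existence,
    uniqueness and functoriality at once, and for [E = G = 0] it recovers
    [theta], because [R -> loc(R,0)] is injective. *)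
From HB Require Import structures.
Require Import Defs.
From mathcomp Require Import all_boot all_order all_algebra.
From mathcomp Require Import finmap all_classical topology.

Set Implicit Arguments.
Unset Strict Implicit.
Unset Printing Implicit Defensive.

Import Order.TTheory GRing.Theory.

Local Open Scope classical_set_scope.
Local Open Scope ring_scope.

(** * Ideals of [L(R)] and open sets of [NCSpec R] *)

Section LocPoset.
Variable R : pzRingType.
Implicit Types (E F : {fset R}) (x y : locposet R).

Lemma loc_le_fsetUl E F : loc_le E (E `|` F)%fset.
Proof. by apply: loc_le_sub => a aE; rewrite in_fsetU aE. Qed.

Lemma loc_le_fsetUr E F : loc_le F (E `|` F)%fset.
Proof. by apply: loc_le_sub => a aF; rewrite in_fsetU aF orbT. Qed.

Lemma cls_repr x : cls (repr x) = x.
Proof. exact: reprK. Qed.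

Lemma open_ge x : open [set y | (x <= y)%O].
Proof. by rewrite -(cls_repr x); exact: open_basic. Qed.

Lemma closed_lower (C : set (locposet R)) x y :
  closed C -> C y -> (x <= y)%O -> C x.
Proof.
move=> /closed_openC /open_upper up Cy xy; apply: contrapT => nCx.
exact: up nCx xy Cy.
Qed.

Lemma sob_set_lower (C : soberification (locposet R)) x y :
  sob_set C y -> (x <= y)%O -> sob_set C x.
Proof. by apply: closed_lower; exact: sob_closed. Qed.

(** Without such a [z], the complements of the upper sets of [x] and [y], both closed, would cover
    [C]; irreducibility puts [C] in one of them, which misses [x] or [y]. *)
Lemma sob_set_directed (C : soberification (locposet R)) x y :
  sob_set C x -> sob_set C y ->
  exists z, [/\ sob_set C z, (x <= z)%O & (y <= z)%O].
Proof.
move=> Cx Cy; apply: contrapT => nz.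
have cU w : closed (~` [set z : locposet R | (w <= z)%O]).
  by apply: open_closedC; exact: open_ge.
have [_ /(_ _ _ (cU x) (cU y))[z Cz|/(_ _ Cx)|/(_ _ Cy)]] := sob_irreducible C.
- rewrite -setCI => -[xz yz]; by apply: nz; exists z.
- by apply; exact: lexx.
- by apply; exact: lexx.
Qed.

Lemma sober_unitP x y : sob_set (sober_unit x) y <-> (y <= x)%O.
Proof.
split=> [xy|]; last by apply: sob_set_lower; exact: subset_closure.
have [|z [-> //]] := xy [set z | (y <= z)%O].
by apply: open_nbhs_nbhs; split; [exact: open_ge|exact: lexx].
Qed.

Lemma opens_NCSpecP (U : opens (NCSpec R)) :
  exists2 V : set (locposet R), open V & carrier U = tilde V.
Proof. exact: opensP U. Qed.

Lemma opens_NCSpec_le (U : opens (NCSpec R)) E F :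
  loc_le E F -> carrier U (sober_unit (cls E)) -> carrier U (sober_unit (cls F)).
Proof.
have [V oV ->] := opens_NCSpecP U.
rewrite -![tilde V _]/((@sober_unit _ @^-1` tilde V) _) sober_unit_tilde//.
by move=> EF VE; apply: (oV _ _ VE); apply/le_cls.
Qed.

Lemma basicOP E (C : soberification (locposet R)) :
  carrier (basicO E) C <-> sob_set C (cls E).
Proof.
split=> [[x [Cx Ex]]|CE]; first exact: sob_set_lower Cx Ex.
by exists (cls E); split=> //; exact: lexx.
Qed.

(** With [U = tilde V], the hypothesis puts [R_E] in [V], so every ideal containing [R_E] meets
    [V]. *)
Lemma basicO_subset (U : opens (NCSpec R)) E :
  carrier U (sober_unit (cls E)) -> basicO E `<=` U.
Proof.
have [V oV ->] := opens_NCSpecP U.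
rewrite -[tilde V _]/((@sober_unit _ @^-1` tilde V) _) sober_unit_tilde// => VE.
by move=> C /basicOP CE; exists (cls E).
Qed.

(** The identity of [R] inverts the empty set, and its lift is a retraction. *)
Lemma alphaf0_inj : injective (alphaf (fset0 : {fset R})).
Proof.
have inv0 : inverts [set` (fset0 : {fset R})] (idfun : {rmorphism R -> R}).
  by move=> a /=; rewrite in_fset0.
by apply: (can_inj (g := loc_lift inv0)) => r; rewrite loc_lift_alpha.
Qed.

End LocPoset.

(** * The map on points *)

Section NCSpecMap.
Variables (R S : pzRingType) (theta : {rmorphism R -> S}).
Implicit Types (E F : {fset R}) (G : {fset S}).

Lemma fim_fsetU_le E F G :
  loc_le (fim theta E) G -> loc_le (fim theta F) G ->
  loc_le (fim theta (E `|` F)%fset) G.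
Proof.
move=> EG FG a /imfsetP[r /= + ->]; rewrite in_fsetU => /orP[rE|rF].
  by apply: EG; exact: in_imfset.
by apply: FG; exact: in_imfset.
Qed.

Lemma fim0_le G : loc_le (fim theta fset0) G.
Proof. by move=> a /imfsetP[r /=]; rewrite in_fset0. Qed.

(** The map [theta_F] carries an inverse of [r] in [loc(R,F)] to an inverse of [theta r]. *)
Lemma loc_le_fim E F : loc_le E F -> loc_le (fim theta E) (fim theta F).
Proof.
move=> EF a /imfsetP[r /= rE ->]; have [y [ry yr]] := EF r rE.
by exists (loc_theta theta F y); rewrite -loc_theta_alpha -!rmorphM ry yr rmorph1.
Qed.

Lemma locp_loc_theta E F (EF : loc_le E F)
    (h : loc_le (fim theta E) (fim theta F)) x :
  locp h (loc_theta theta E x) = loc_theta theta F (locp EF x).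
Proof.
apply: (locf_rmorph_eq (f := locp h \o loc_theta theta E)
                       (g := loc_theta theta F \o locp EF)) => r /=.
by rewrite loc_theta_alpha !locp_alpha loc_theta_alpha.
Qed.

Definition fhat_set (C : set (locposet S)) : set (locposet R) :=
  [set cls E | E in [set E | C (cls (fim theta E))]].

(** An image only provides some representative; monotonicity of [fim] makes membership independent
    of it. *)
Lemma fhat_set_cls (C : soberification (locposet S)) E :
  fhat_set (sob_set C) (cls E) <-> sob_set C (cls (fim theta E)).
Proof.
split=> [[F /= CF /cls_eq[_ EF]]|CE]; last by exists E.
by apply: sob_set_lower CF _; apply/le_cls; exact: loc_le_fim.
Qed.

Lemma fhat_closed (C : soberification (locposet S)) :
  closed (fhat_set (sob_set C)).
Proof.
rewrite -[X in closed X]setCK; apply/open_closedC/open_upper => x y.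
rewrite -[x]cls_repr -[y]cls_repr => nCx /le_cls xy /fhat_set_cls Cy.
apply: nCx; apply/fhat_set_cls; apply: sob_set_lower Cy _.
by apply/le_cls; exact: loc_le_fim.
Qed.

Lemma fhat_irreducible (C : soberification (locposet S)) :
  irreducible (fhat_set (sob_set C)).
Proof.
split.
  have [[y Cy] _] := sob_irreducible C.
  exists (cls fset0); apply/fhat_set_cls; apply: sob_set_lower Cy _.
  by rewrite -[y]cls_repr; apply/le_cls; exact: fim0_le.
move=> A B cA cB CAB; apply: contrapT => /not_orP[].
move=> /existsNP[_ /not_implyP[[E CE <-] nAE]].
move=> /existsNP[_ /not_implyP[[F CF <-] nBF]].
have [z []] := sob_set_directed CE CF.
rewrite -[z]cls_repr => Cz /le_cls Ez /le_cls Fz.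
(* Directedness of [C] puts the union in the preimage; whichever of [A], [B] contains it is a lower
   set, so contains [E] or [F] respectively. *)
have /CAB[AEF|BEF] : fhat_set (sob_set C) (cls (E `|` F)%fset).
- apply/fhat_set_cls; apply: sob_set_lower Cz _.
  by apply/le_cls; exact: fim_fsetU_le.
- apply: nAE; apply: closed_lower cA AEF _.
  by apply/le_cls; exact: loc_le_fsetUl.
- apply: nBF; apply: closed_lower cB BEF _.
  by apply/le_cls; exact: loc_le_fsetUr.
Qed.

Definition fhat (C : soberification (locposet S)) :
    soberification (locposet R) :=
  Soberification (@fhat_closed C) (@fhat_irreducible C).

Lemma fhat_continuous : continuous fhat.
Proof.
apply/continuousP => _ [U oU ->].
(* [C] maps into [tilde U] exactly when it contains the class of [theta(E)] for some [E] in [U]. *)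
exists (\bigcup_(E in [set E | U (cls E)]) basicL (fim theta E)).
  by apply: bigcup_open => E _; exact: opensP.
apply/seteqP; split=> [C [_ [[E CE <-] UE]]|C [y [Cy [E UE Ey]]]].
  exists (cls (fim theta E)); split=> //; exists E => //; exact: lexx.
exists (cls E); split=> //; apply/fhat_set_cls; exact: sob_set_lower Cy Ey.
Qed.

HB.instance Definition _ := @isContinuous.Build (soberification (locposet S))
  (soberification (locposet R)) fhat fhat_continuous.

(** Stated for any [f] with the right action on points, so that it serves both [fhat] and the
    arbitrary maps in the uniqueness proof. *)
Lemma preim_sober_unitP (f : NCSpec S -> NCSpec R) (U : opens (NCSpec R)) G :
  (forall C, sob_set (f C) = fhat_set (sob_set C)) ->
  carrier U (f (sober_unit (cls G))) <->
  exists2 E, carrier U (sober_unit (cls E)) & loc_le (fim theta E) G.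
Proof.
move=> fE; split=> [|[E /basicO_subset EU EG]].
  have [V oV ->] := opens_NCSpecP U => -[x []]; rewrite fE => -[E /= + <-] VE.
  move=> /sober_unitP/le_cls EG; exists E => //.
  by exists (cls E); split=> //; exact/sober_unitP.
by apply: EU; apply/basicOP; rewrite fE; exists E => //; exact/sober_unitP/le_cls.
Qed.

(** * The formula for the sheaf morphism *)

Lemma locp_loc_theta_indep (U : opens (NCSpec R))
    (s : Lsection (@sober_unit (locposet R) @^-1` U)) E F G
    (hE : carrier U (sober_unit (cls E))) (hF : carrier U (sober_unit (cls F)))
    (EG : loc_le (fim theta E) G) (FG : loc_le (fim theta F) G) :
  locp EG (loc_theta theta E (lval s hE)) =
  locp FG (loc_theta theta F (lval s hF)).
Proof.
have EEF := @loc_le_fsetUl _ E F; have FEF := @loc_le_fsetUr _ E F.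
have hEF : carrier U (sober_unit (cls (E `|` F)%fset)) := opens_NCSpec_le EEF hE.
have EFG := fim_fsetU_le EG FG.
rewrite -(locp_comp (loc_le_fim EEF) EFG EG) (locp_loc_theta EEF).
rewrite -(locp_comp (loc_le_fim FEF) EFG FG) (locp_loc_theta FEF).
by rewrite (lvalP s hE hEF EEF) (lvalP s hF hEF FEF).
Qed.

Definition sharp_formula (f : rs_hom (NCSpec S) (NCSpec R)) : Prop :=
  forall (U : opens (NCSpec R)) (s : structure_sheaf (NCSpec R) U) E G
    (hE : carrier U (sober_unit (cls E))) (hG : carrier U (f (sober_unit (cls G))))
    (EG : loc_le (fim theta E) G),
  @lval S (@sober_unit (locposet S) @^-1` (f @^-1` U)) (rs_sharp f U s) G hG =
  locp EG (loc_theta theta E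
    (@lval R (@sober_unit (locposet R) @^-1` U) s E hE)).

Lemma is_NCSpec_mapP (f : rs_hom (NCSpec S) (NCSpec R)) :
  is_NCSpec_map theta f <->
  (forall C, sob_set (f C) = fhat_set (sob_set C)) /\ sharp_formula f.
Proof.
split=> [[fE fB]|[fE fS]]; split=> //.
- move=> U s E G hE hG EG.
  have [preE evE] := fB E.
  have h1 : basicO (fim theta E) `<=` preimO f (basicO E).
    by rewrite /= preE.
  have h2 : basicO E `<=` U := basicO_subset hE.
  have hfE : carrier U (f (sober_unit (cls (fim theta E)))).
    by apply/(preim_sober_unitP _ _ fE); exists E => //; exact: loc_le_refl.
  (* Restricting [s] to [tilde U_E] gives its image at [theta(E)]; compatibility of the section
     carries that value to [G]. *)
  have := evE h1 (res (structure_sheaf (NCSpec R)) h2 s).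
  rewrite componentN [RHS]/(loc_theta _ _ (lval _ _)) /NCSpec_ev /Lev /=.
  rewrite (lval_irr _ _ hE) => <-.
  rewrite (lval_irr _ _ hfE).
  by symmetry; exact: lvalP.
- move=> E; have preE : f @^-1` (basicO E) = basicO (fim theta E).
    apply/seteqP; split=> C; rewrite /preimage /=.
      by move=> /basicOP; rewrite fE => /fhat_set_cls; exact: (basicOP _ _).2.
    by move=> /basicOP CE; apply/basicOP; rewrite fE; exact/fhat_set_cls.
  split=> // h s; rewrite /NCSpec_ev /Lev /=.
  (* This is the formula with [G] equal to [theta(E)]. *)
  rewrite -[RHS](locp_id (@loc_le_refl _ _)).
  exact: fS.
Qed.

(** * Construction of the sheaf morphism *)

Section Sharp.
Variable U : opens (NCSpec R).

Let dom := @sober_unit (locposet S) @^-1` (fhat @^-1` U).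

Lemma sharp_witness G :
  dom (cls G) -> {E | carrier U (sober_unit (cls E)) /\ loc_le (fim theta E) G}.
Proof.
move=> dG; apply: cid.
have [E UE EG] := (preim_sober_unitP (f := fhat) U G (fun=> erefl)).1 dG.
by exists E.
Qed.

Definition sharp_val (s : structure_sheaf (NCSpec R) U) G (h : dom (cls G)) :
    locf G :=
  let E := sharp_witness h in
  locp (svalP E).2 (loc_theta theta (sval E)
    (@lval R (@sober_unit (locposet R) @^-1` U) s _ (svalP E).1)).

Lemma sharp_valE s E G (h : dom (cls G)) (hE : carrier U (sober_unit (cls E)))
    (EG : loc_le (fim theta E) G) :
  sharp_val s h = locp EG (loc_theta theta E
    (@lval R (@sober_unit (locposet R) @^-1` U) s E hE)).
Proof. exact: locp_loc_theta_indep. Qed.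

Lemma sharp_val_compat s G H (hG : dom (cls G)) (hH : dom (cls H))
    (GH : loc_le G H) : locp GH (sharp_val s hG) = sharp_val s hH.
Proof.
have [E [hE EG]] := sharp_witness hG.
rewrite (sharp_valE s hG hE EG) (sharp_valE s hH hE (loc_le_trans EG GH)).
exact: locp_comp.
Qed.

Definition sharp_section (s : structure_sheaf (NCSpec R) U) : Lsection dom :=
  LSection (@sharp_val_compat s).

(** The chosen [E] depends on [G] but not on [s], so each value is a composite of ring homomorphisms
    applied to a value of [s]. *)
Lemma sharp_section_nmod_morphism : nmod_morphism sharp_section.
Proof.
split=> [|s t]; apply: (@Lsection_ext S dom) => G h.
  by rewrite /= /sharp_val /= !rmorph0.
by rewrite /= /sharp_val /= !rmorphD.
Qed.

Lemma sharp_section_monoid_morphism : monoid_morphism sharp_section.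
Proof.
split=> [|s t]; apply: (@Lsection_ext S dom) => G h.
  by rewrite /= /sharp_val /= !rmorph1.
by rewrite /= /sharp_val /= !rmorphM.
Qed.

HB.instance Definition _ := GRing.isNmodMorphism.Build
  (structure_sheaf (NCSpec R) U) (Lsection dom) sharp_section
  sharp_section_nmod_morphism.
HB.instance Definition _ := GRing.isMonoidMorphism.Build
  (structure_sheaf (NCSpec R) U) (Lsection dom) sharp_section
  sharp_section_monoid_morphism.
End Sharp.

Definition fhat_sharp : presheaf_hom (structure_sheaf (NCSpec R))
  (pushforward fhat (structure_sheaf (NCSpec S))).
Proof.
refine (@PresheafHom _ _ (pushforward fhat (structure_sheaf (NCSpec S)))
  (fun U => @sharp_section U) _).
move=> U V VU s; apply: Lsection_ext => G hG /=.
(* An [E] found in the smaller open set [V] also serves for [U]. *)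
have [E [hE EG]] := sharp_witness hG.
rewrite (sharp_valE _ _ hE EG) /=.
by symmetry; exact: sharp_valE.
Defined.

Definition NCSpec_map : rs_hom (NCSpec S) (NCSpec R) :=
  @RsHom (NCSpec S) (NCSpec R) fhat fhat_sharp.

Lemma NCSpec_mapP : is_NCSpec_map theta NCSpec_map.
Proof.
by apply/is_NCSpec_mapP; split=> // U s E G hE hG EG; exact: sharp_valE.
Qed.

(** Every [G] in the preimage of [U] admits an [E] as in [preim_sober_unitP], so [sharp_formula]
    fixes all values. *)
Lemma NCSpec_map_uniq (f g : rs_hom (NCSpec S) (NCSpec R)) :
  is_NCSpec_map theta f -> is_NCSpec_map theta g -> f = g.
Proof.
move=> /is_NCSpec_mapP[fE fS] /is_NCSpec_mapP[gE gS].
apply: rs_hom_ext => [C|U h s]; first by apply: sob_ext; rewrite fE gE.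
apply: Lsection_ext => G hG.
have [E hE EG] := (preim_sober_unitP U G gE).1 hG.
transitivity (locp EG (loc_theta theta E
    (@lval R (@sober_unit (locposet R) @^-1` U) s E hE))).
  by rewrite -(fS U s E G hE (h _ hG) EG) /=; exact: lval_irr.
by symmetry; exact: gS.
Qed.

End NCSpecMap.

(** * Identity and composition *)

Lemma is_NCSpec_map_id (R : pzRingType) :
  is_NCSpec_map (idfun : {rmorphism R -> R}) (rs_id (NCSpec R)).
Proof.
apply/is_NCSpec_mapP; split=> [C|U s E G hE hG EG].
  apply/seteqP; split=> x; rewrite -[x]cls_repr.
    by move=> Cx; apply/fhat_set_cls; move: Cx; rewrite /fim imfset_id.
  by move=> /fhat_set_cls; rewrite /fim imfset_id.
have EG' : loc_le E G by move: EG; rewrite /fim imfset_id.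
transitivity (locp EG' (@lval R (@sober_unit (locposet R) @^-1` U) s E hE)).
  by symmetry; exact: lvalP.
(* [fim idfun E] is equal but not convertible to [E], so the two maps out of [loc(R,E)] are compared
   on the image of [R]. *)
apply: (locf_rmorph_eq (f := locp EG')
  (g := locp EG \o loc_theta idfun E)) => r /=.
by rewrite loc_theta_alpha !locp_alpha.
Qed.

Lemma is_NCSpec_map_comp (R S T : pzRingType) (theta : {rmorphism R -> S})
    (eta : {rmorphism S -> T}) (f : rs_hom (NCSpec S) (NCSpec R))
    (g : rs_hom (NCSpec T) (NCSpec S)) :
  is_NCSpec_map theta f -> is_NCSpec_map eta g ->
  is_NCSpec_map (eta \o theta) (rs_comp f g).
Proof.
move=> /is_NCSpec_mapP[fE fS] /is_NCSpec_mapP[gE gS].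
have fim_comp E : fim (eta \o theta) E = fim eta (fim theta E).
  by rewrite /fim -imfset_comp.
apply/is_NCSpec_mapP; split=> [C|U s E G hE hG EG].
  rewrite [LHS]fE gE; apply/seteqP; split=> x; rewrite -[x]cls_repr.
    move=> [E /= /fhat_set_cls CE <-].
    by apply/fhat_set_cls; rewrite fim_comp.
  move=> /fhat_set_cls; rewrite fim_comp => CE.
  by exists (repr x) => //=; exact/fhat_set_cls.
(* The intermediate index is [theta(E)]: the formula for [f] is read there, and the one for [g] goes
   from there to [G]. *)
have hfE : carrier U (f (sober_unit (cls (fim theta E)))).
  by apply/(preim_sober_unitP _ _ fE); exists E => //; exact: loc_le_refl.
have EG' : loc_le (fim eta (fim theta E)) G by rewrite -fim_comp.
transitivity (@lval T (@sober_unit (locposet T) @^-1` (g @^-1` (preimO f U)))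
  (rs_sharp g (preimO f U) (rs_sharp f U s)) G hG).
  by rewrite /=; exact: lval_irr.
rewrite (gS (preimO f U) _ (fim theta E) G hfE hG EG').
rewrite (fS U s E _ hE hfE (@loc_le_refl _ _)) locp_id.
apply: (locf_rmorph_eq
  (f := locp EG' \o (loc_theta eta (fim theta E) \o loc_theta theta E))
  (g := locp EG \o loc_theta (eta \o theta) E)) => r /=.
by rewrite !loc_theta_alpha !locp_alpha.
Qed.

(** * Faithfulness *)

Lemma NCSpec_map_inj (R S : pzRingType) : injective (@NCSpec_map R S).
Proof.
move=> theta eta eq_f; apply: rmorphism_ext => r; apply: alphaf0_inj.
(* The single map [NCSpec_map eta] now satisfies the formulas of both [theta] and [eta]. *)
have := NCSpec_mapP theta; rewrite eq_f => /is_NCSpec_mapP[fE fS].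
have /is_NCSpec_mapP[_ gS] := NCSpec_mapP eta.
have h0 := @basicO_cls R fset0.
have hG : carrier (basicO fset0) (NCSpec_map eta (sober_unit (cls fset0))).
  by apply/(preim_sober_unitP _ _ fE); exists fset0 => //; exact: fim0_le.
(* Inverting the evaluation yields a section whose value at the empty set is the image of [r]. *)
have [ev _ evK] := NCSpec_ev_bij (fset0 : {fset R}).
have sE : @lval R (@sober_unit (locposet R) @^-1` basicO fset0)
    (ev (alphaf fset0 r)) fset0 h0 = alphaf fset0 r.
  by rewrite -[RHS]evK; exact: lval_irr.
have := fS _ (ev (alphaf fset0 r)) fset0 fset0 h0 hG (@fim0_le _ _ _ _).
rewrite (gS _ _ fset0 fset0 h0 hG (@fim0_le _ _ _ _)) !sE.
by rewrite !loc_theta_alpha !locp_alpha.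
Qed.

Theorem theorem7p4 :
  (forall (R S : pzRingType) (theta : {rmorphism R -> S}),
     exists! f : rs_hom (NCSpec S) (NCSpec R), is_NCSpec_map theta f) /\
  (exists F : forall R S : pzRingType,
       {rmorphism R -> S} -> rs_hom (NCSpec S) (NCSpec R),
     (forall (R S : pzRingType) (theta : {rmorphism R -> S}),
        is_NCSpec_map theta (F R S theta)) /\
     @is_contravariant_functor ring_category ringed_space_category NCSpec F /\
     @is_faithful ring_category ringed_space_category NCSpec F).
Proof.
split=> [R S theta|].
  exists (NCSpec_map theta); split=> [|f]; first exact: NCSpec_mapP.
  exact/NCSpec_map_uniq/NCSpec_mapP.
exists NCSpec_map; split; first exact: NCSpec_mapP.
split; last exact: NCSpec_map_inj.
split=> [R|R S T eta theta].
  exact: NCSpec_map_uniq (NCSpec_mapP _) (is_NCSpec_map_id R).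
apply: NCSpec_map_uniq (NCSpec_mapP _) _.
exact: is_NCSpec_map_comp (NCSpec_mapP theta) (NCSpec_mapP eta).
Qed.
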